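(* Let $(X,\|\cdot\|)$ be a normed linear space, let $r\ge 0$ and $0<\alpha\le 1$, and let $x=\{x_n\}_{n\in\mathbb{N}}$ be a sequence in $X$. Then the rough statistical limit set of order $\alpha$, $st\text{-}LIM_x^{r^{\alpha}}$, is convex.
   Context: Let $x=\{x_n\}_{n\in\mathbb{N}}$ be a sequence in a normed linear space $(X,\|\cdot\|)$, $0<\alpha\le 1$ and $r\ge 0$. The sequence $x$ is rough statistically convergent of order $\alpha$ to $\xi\in X$ (with roughness degree $r$) if for every $\varepsilon>0$, $\lim_{n\to\infty}\frac{1}{n^{\alpha}}|\{k\le n:\|x_k-\xi\|\ge r+\varepsilon\}|=0$. The set of all such $\xi\in X$ is denoted $st\text{-}LIM_x^{r^{\alpha}}$. Here $|A|$ is the number of elements of $A$, and $r^{\alpha}$ in the notation is only a label recording $r$ and $\alpha$, not a power. *)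

(* Defs.v *)
From mathcomp Require Import all_boot all_order all_algebra.
From mathcomp Require Import all_classical all_reals all_analysis.

Set Implicit Arguments.
Unset Strict Implicit.
Unset Printing Implicit Defensive.

Import Order.TTheory GRing.Theory Num.Theory.
Import numFieldNormedType.Exports.

Local Open Scope classical_set_scope.
Local Open Scope ring_scope.

(* The scalar field K is any numFieldType, so that real (K : realType) and
   complex (K = R[i]) normed spaces are both covered; norms take their values
   in K. For K = R[i], 0 <= r and 0 < e force r and e to be real. The order
   alpha and the densities live in the separate real field R. *)

(* Sequences are indexed by {1, 2, ...}: the term x 0 is never counted. *)
Definition rough_count (K : numFieldType) (X : normedModType K)
    (x : nat -> X) (r e : K) (xi : X) (n : nat) : nat :=
  #|[pred k : 'I_n.+1 | (0 < k)%N && (r + e <= `|x k - xi|)]|.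

Definition rough_stat_cvg (R : realType) (K : numFieldType)
    (X : normedModType K) (x : nat -> X) (r : K) (alpha : R) (xi : X) : Prop :=
  forall e : K, 0 < e ->
    (fun n : nat => (rough_count x r e xi n)%:R / n%:R `^ alpha : R) @ \oo
      --> (0 : R).

Definition rough_stat_LIM (R : realType) (K : numFieldType)
    (X : normedModType K) (x : nat -> X) (r : K) (alpha : R) : set X :=
  [set xi | rough_stat_cvg x r alpha xi].

(* Main.v *)
(** If [x k] is at distance less than [r + e] from both [y] and [z], then it is
    so from every convex combination of them. Hence the indices that are bad
    for the combination are bad for [y] or for [z], the corresponding counts
    are subadditive, and the ratio is squeezed between 0 and a sum of two
    ratios tending to 0. *)

Require Import Defs.
From mathcomp Require Import all_boot all_order all_algebra.
From mathcomp Require Import all_classical all_reals all_analysis.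

Import Order.TTheory GRing.Theory Num.Theory.
Import numFieldNormedType.Exports.

Local Open Scope classical_set_scope.
Local Open Scope ring_scope.

(** The weights sum to 1, so the difference is the same combination of [w - y] and [w - z]. *)
Lemma ltr_norm_sub_conv (K : numFieldType) (X : normedModType K) (w y z : X)
    (t s : K) :
  0 < t -> t < 1 -> `|w - y| < s -> `|w - z| < s ->
  `|w - (t *: y + (1 - t) *: z)| < s.
Proof.
move=> t0 t1 wy wz; have t1' : 0 < 1 - t by rewrite subr_gt0.
have -> : w - (t *: y + (1 - t) *: z) = t *: (w - y) + (1 - t) *: (w - z).
  by rewrite !scalerBr addrACA -scalerDl subrKC scale1r opprD.
have -> : s = t * s + (1 - t) * s by rewrite -mulrDl subrKC mul1r.
apply: le_lt_trans (ler_normD _ _) _; rewrite !normrZ !gtr0_norm//.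
by apply: ltrD; rewrite ltr_pM2l.
Qed.

Lemma rough_count_conv (K : numFieldType) (X : normedModType K) (x : nat -> X)
    (r e t : K) (y z : X) (n : nat) :
  0 <= r -> 0 < e -> 0 < t -> t < 1 ->
  (rough_count x r e (t *: y + (1 - t) *: z)%R n <=
   rough_count x r e y n + rough_count x r e z n)%N.
Proof.
move=> r0 e0 t0 t1; rewrite /rough_count -cardUI.
(* Drop the intersection term from [cardUI]; inclusion in the union remains. *)
apply/(leq_trans _ (leq_addr _ _))/subset_leq_card; apply/fintype.subsetP => k.
rewrite !inE => /andP[-> /=] h; apply/negPn/negP; rewrite negb_or.
(* [K] may be only partially ordered: negating [<=] into [<] requires both sides real. *)
have re : r + e \is Num.real by rewrite realD// ?ger0_real// ltW.
rewrite -!real_ltNge ?normr_real// => /andP[wy wz].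
by have := lt_le_trans (ltr_norm_sub_conv _ _ _ _ _ _ _ t0 t1 wy wz) h;
  rewrite ltxx.
Qed.

Theorem theorem3p4 (R : realType) (K : numFieldType) (X : normedModType K)
    (r : K) (alpha : R) (x : nat -> X) :
  0 <= r -> 0 < alpha <= 1 ->
  convex_set (rough_stat_LIM x r alpha).
Proof.
(* [convex_setW] leaves only weights strictly between 0 and 1. *)
move=> r0 _; apply/convex_setW => y z /set_mem yl /set_mem zl t t0 t1.
apply/mem_set => e e0.
have /= := cvgD (yl e e0) (zl e e0); rewrite addr0 => yz.
apply: (squeeze_cvgr _ (cvg_cst 0) (yz _)); near=> n.
rewrite divr_ge0 ?powR_ge0 ?ler0n//= fctE -mulrDl.
rewrite ler_wpM2r ?invr_ge0 ?powR_ge0//.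
by rewrite -natrD ler_nat rough_count_conv.
Unshelve. all: by end_near.
Qed.
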